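(* For any two real numbers $x,y\in(0,1)$, there exists a faithful function $f\in\mathcal F$ such that $E_f(x)=E_r(y)$; that is, the continued $f$-expansion of $x$ is the same sequence as the usual continued fraction expansion of $y$.
   Context: For real $x$, $\lfloor x\rfloor$ is the greatest integer $\le x$ and $\{x\}=x-\lfloor x\rfloor$. Let $\mathcal C_i$ be the set of formal infinite integer sequences $[a_0;a_1,a_2,\dots]$ with $a_j\ge1$ for all $j\ge1$, and $\mathcal C_t$ the set of formal finite integer sequences $[a_0;a_1,\dots,a_n]$ ($n\ge0$) with $a_j\ge1$ for $1\le j\le n$ and $a_n\ge2$ if $n\ge1$; put $\mathcal C=\mathcal C_i\cup\mathcal C_t$ (elements are formal sequences, not numbers). Let $\mathcal F$ be the set of strictly decreasing continuous functions $f:(1,\infty)\to(0,1)$ with $\lim_{x\to1^+}f(x)=1$ and $\lim_{x\to+\infty}f(x)=0$, and for $f\in\mathcal F$ let $\phi=f^{-1}:(0,1)\to(1,\infty)$. The expansion function $E_f:\mathbb R\to\mathcal C$ is defined as follows: given $x_0\in\mathbb R$, set $a_0=\lfloor x_0\rfloor$; if $x_k$ is not an integer, set $x_{k+1}=\phi(\{x_k\})$ and $a_{k+1}=\lfloor x_{k+1}\rfloor$. If some $x_n$ is an integer (take the first such), $E_f(x_0)=[a_0;a_1,\dots,a_n]\in\mathcal C_t$; otherwise $E_f(x_0)=[a_0;a_1,a_2,\dots]\in\mathcal C_i$. The evaluation function $V_f$ is defined on $\mathcal C_t$ by $V_f([a_0])=a_0$ and $V_f([a_0;a_1,\dots,a_n])=a_0+f(V_f([a_1;a_2,\dots,a_n]))$,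 and on $[a_0;a_1,a_2,\dots]\in\mathcal C_i$ by $V_f([a_0;a_1,a_2,\dots])=\lim_{n\to\infty}V_f([a_0;a_1,\dots,a_n])$ whenever this limit exists. Let $r(x)=1/x$ on $(1,\infty)$, so $r\in\mathcal F$ and $E_r$ is the usual continued fraction expansion. A function $f\in\mathcal F$ is called faithful if $V_f$ is defined on all of $\mathcal C$ and $E_f:\mathbb R\to\mathcal C$ is a bijection whose inverse is $V_f$. *)

(* Defs.v *)
From HB Require Import structures.
From mathcomp Require Export all_boot all_order all_algebra.
From mathcomp Require Export all_classical all_reals all_analysis.

Set Implicit Arguments.
Unset Strict Implicit.
Unset Printing Implicit Defensive.

Export Order.TTheory GRing.Theory Num.Theory.
Export numFieldNormedType.Exports.

#[global] Open Scope classical_set_scope.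
#[global] Open Scope ring_scope.

(* [CFfin a0 [:: a1; ..; an]] is [a0; a1, .., an], and
   [CFinf a] is [a 0; a 1, a 2, ..]. *)
Inductive cfseq : Type :=
| CFfin of int & seq int
| CFinf of nat -> int.

Definition cf_t : set cfseq := [set c | exists a0 s,
  [/\ c = CFfin a0 s, all (fun a => 1 <= a) s & s != [::] -> 2 <= last a0 s]].

Definition cf_i : set cfseq := [set c | exists a,
  c = CFinf a /\ forall j : nat, (1 <= j)%N -> 1 <= a j].

Definition cf_set : set cfseq := cf_t `|` cf_i.

Section ContinuedFExpansion.
Variable R : realType.
Implicit Types (f : R -> R) (x : R).

(* Functions on ]1, +oo[ are total functions; the values outside ]1, +oo[ are
   irrelevant. *)
Definition classF : set (R -> R) := [set f : R -> R |
  [/\ set_fun `]1, +oo[ `]0, 1[ f,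
      {in `]1, +oo[ &, forall u v, u < v -> f v < f u},
      {in `]1, +oo[, continuous f},
      f u @[u --> 1^'+] --> (1 : R)
    & f u @[u --> +oo] --> (0 : R)]].

Definition fracpart x : R := x - (Num.floor x)%:~R.

(* On `]0, 1[ this is the inverse bijection when f is in classF. *)
Definition phi f : R -> R := pinv (`]1, +oo[ : set R) f.

(* The k-th complete quotient x_k; it is meaningful as long as
   x_0, .., x_(k-1) are not integers. *)
Definition cquot f x (k : nat) : R := iter k (fun t => phi f (fracpart t)) x.

Definition pquot f x (k : nat) : int := Num.floor (cquot f x k).

Definition expansion f x : cfseq :=
  match pselect (exists n, cquot f x n \is a Num.int) with
  | left h => CFfin (pquot f x 0) [seq pquot f x k | k <- iota 1 (ex_minn h)]
  | right _ => CFinf (pquot f x)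
  end.

(* A truncation [a0; a1, .., an] of an infinite sequence may have a_n = 1, so
   that its evaluation involves f 1: the continuous extension by f 1 = 1 is
   meant, for which [a0; .., a, 1] and [a0; .., a + 1] have the same value. *)
Definition ext1 f x : R := if x == 1 then 1 else f x.

Fixpoint eval_fin f (a0 : int) (s : seq int) : R :=
  if s is a1 :: s' then a0%:~R + ext1 f (eval_fin f a1 s') else a0%:~R.

Definition convergent f (a : nat -> int) (n : nat) : R :=
  eval_fin f (a 0) [seq a k | k <- iota 1 n].

Definition evaluation f (c : cfseq) : R :=
  match c with
  | CFfin a0 s => eval_fin f a0 s
  | CFinf a => limn (convergent f a)
  end.

Definition evaluation_defined f (c : cfseq) : Prop :=
  match c with
  | CFfin _ _ => True
  | CFinf a => cvgn (convergent f a)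
  end.

Definition faithful f : Prop :=
  [/\ classF f,
      forall c, cf_set c -> evaluation_defined f c,
      set_bij [set: R] cf_set (expansion f),
      forall x, evaluation f (expansion f x) = x
    & forall c, cf_set c -> expansion f (evaluation f c) = c].

Definition recip : R -> R := fun u => u^-1.

End ContinuedFExpansion.

(* Main.v *)
(* For c > 0 the Moebius map t |-> c t / (1 - t + c t) is an increasing
   bijection of [0, 1] with inverse of the same shape (for 1 / c).  Applied to
   fractional parts it gives an increasing bijection H of R which commutes with
   integer translations.  Conjugating 1 / u by H yields f in F whose expansion
   of H t is the usual expansion of t, so it suffices to choose c such that
   H y = x.
   Every f in F whose convergents all converge is faithful, and the convergents
   of f are the images under H of the usual ones; the latter converge since two
   steps of the continued fraction contract distances by 1 / 4. *)
Require Import Defs.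
From mathcomp Require Import ring lra zify.

Set Implicit Arguments.
Unset Strict Implicit.

(** * Integer and fractional parts *)

Section Fractional.
Variable R : realType.
Implicit Types (x t : R) (m : int).

Lemma floor_int_add m t : 0 <= t < 1 -> Num.floor (m%:~R + t) = m.
Proof. by move=> t01; apply: floor_def; rewrite intrD; lra. Qed.

Lemma fracpart_int_add m t : 0 <= t < 1 -> fracpart (m%:~R + t) = t.
Proof. by move=> t01; rewrite /fracpart floor_int_add // addrC addKr. Qed.

Lemma fracpart_itv x : 0 <= fracpart x < 1.
Proof. by have := floor_itv x; rewrite /fracpart intrD; lra. Qed.

Lemma floor_fracpart x : x = (Num.floor x)%:~R + fracpart x.
Proof. by rewrite /fracpart addrC subrK. Qed.

Lemma int_fracpart x : (x \is a Num.int) = (fracpart x == 0).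
Proof. by rewrite intrEfloor /fracpart subr_eq0 eq_sym. Qed.

Lemma fracpart_itvoo x : x \isn't a Num.int -> 0 < fracpart x < 1.
Proof.
rewrite int_fracpart => xn0; have /andP[x0 ->] := fracpart_itv x.
by rewrite lt_def xn0 x0.
Qed.

Lemma floor_ge1 x : 1 < x -> 1 <= Num.floor x.
Proof. by move=> x1; rewrite floor_ge_int ltW. Qed.

End Fractional.

(** * Decreasing bijections from ]1, +oo[ onto ]0, 1[ and their expansions *)

Section DecreasingBijection.
Variables (R : realType) (f : R -> R).
Hypothesis f_itv : forall u, 1 < u -> 0 < f u < 1.
Hypothesis f_lt : forall u v, 1 < u -> u < v -> f v < f u.
Hypothesis f_surj : forall t, 0 < t < 1 -> exists2 u, 1 < u & f u = t.
Implicit Types (a : nat -> int) (X : nat -> R).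

(** A monotone surjection onto an interval has no jumps: preimages of values close to the target
    bracket the argument, which gives continuity and both limits. *)
Lemma classF_decreasing_bijection : classF f.
Proof.
(* Having [d < 1] as well as [d < e] keeps the values used below inside ]0, 1[, where [f_surj]
   provides preimages. *)
have shrink e : 0 < e -> exists d : R, [/\ 0 < d, d < 1 & d < e].
  move=> e0; exists (e / (1 + e)).
  by split; rewrite ?divr_gt0 ?ltr_pdivrMr; nra.
split.
- by move=> u; rewrite /= !in_itv /= andbT => /f_itv.
- by move=> u v; rewrite !in_itv /= !andbT => u1 _; exact: f_lt.
- move=> u; rewrite in_itv /= andbT => u1; apply/cvgrPdist_lt => e e0.
  have /andP[fu0 fu1] := f_itv u1.
  have [d [d0 d1 de]] := shrink _ e0.
  (* [f p] moves from [f u] a proportion [d] of the way to 1, [f q] the same proportion towards 0;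
     hence [p < u < q], and [f] stays within [e] of [f u] on ]p, q[. *)
  have [p p1 fp] := @f_surj (f u + (1 - f u) * d) ltac:(nra).
  have [q q1 fq] := @f_surj (f u - f u * d) ltac:(nra).
  have pu : p < u.
    rewrite ltNge le_eqVlt; apply/negP => /orP[/eqP up|/(f_lt u1)]; last nra.
    by move: fp; rewrite -up; nra.
  have uq : u < q.
    rewrite ltNge le_eqVlt; apply/negP => /orP[/eqP up|/(f_lt q1)]; last nra.
    by move: fq; rewrite up; nra.
  near=> t.
  have /(f_lt p1) tp : p < t by near: t; exact: lt_nbhsr.
  have tq : t < q by near: t; exact: lt_nbhsl.
  have : 1 < t by near: t; exact: lt_nbhsr.
  move=> /f_lt/(_ tq) {}tq; rewrite ltr_norml; nra.
- apply/cvgrPdist_lt => e e0.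
  have [d [d0 d1 de]] := shrink _ e0.
  have [w w1 fw] := @f_surj (1 - d) ltac:(lra).
  near=> t.
  have t1 : 1 < t by near: t; exact: nbhs_right_gt.
  have tw : t < w by near: t; exact: nbhs_right_lt.
  have := f_lt t1 tw; have := f_itv t1; rewrite ltr_norml; lra.
- apply/cvgrPdist_lt => e e0; have [d [d0 d1 de]] := shrink _ e0.
  have [w w1 fw] := @f_surj d ltac:(lra).
  near=> t.
  have wt : w < t by near: t; apply: nbhs_pinfty_gt; rewrite num_real.
  have := f_lt w1 wt; have := f_itv (lt_trans w1 wt); rewrite ltr_norml; lra.
Unshelve. all: by end_near. Qed.

Lemma f_inj u v : 1 < u -> 1 < v -> f u = f v -> u = v.
Proof.
move=> u1 v1 fuv; case: (ltgtP u v) => // [/(f_lt u1)|/(f_lt v1)];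
  by rewrite fuv ltxx.
Qed.

Lemma phiK u : 1 < u -> phi f (f u) = u.
Proof.
move=> u1; rewrite /phi pinvKV //; last by rewrite inE /= in_itv /= u1.
by move=> s t; rewrite !inE /= !in_itv /= !andbT; exact: f_inj.
Qed.

Lemma phi_gt1 t : 0 < t < 1 -> 1 < phi f t.
Proof. by move=> /f_surj[u u1 <-]; rewrite phiK. Qed.

Lemma f_phi t : 0 < t < 1 -> f (phi f t) = t.
Proof. by move=> /f_surj[u u1 <-]; rewrite phiK. Qed.

Lemma ext1_itv u : 1 <= u -> 0 < ext1 f u <= 1.
Proof.
rewrite /ext1 le_eqVlt eq_sym; case: eqP => /= [_ _|_ /f_itv]; lra.
Qed.

Lemma ext1_gt1 u : 1 < u -> ext1 f u = f u.
Proof. by move=> u1; rewrite /ext1 gt_eqF. Qed.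

Lemma ext1_le u v : 1 <= u -> u <= v -> ext1 f v <= ext1 f u.
Proof.
move=> u1; rewrite le_eqVlt => /orP[/eqP-> //|uv].
have v1 := le_lt_trans u1 uv; rewrite (ext1_gt1 v1).
move: u1; rewrite /ext1 le_eqVlt eq_sym; case: eqP => /= [_ _|_ u1].
  by have := f_itv v1; lra.
exact/ltW/f_lt.
Qed.

(** * Complete quotients, chains and expansions *)

Lemma cquotSn x n : cquot f x n.+1 = phi f (fracpart (cquot f x n)).
Proof. by []. Qed.

Lemma cquot_step x n : cquot f x n \isn't a Num.int ->
  1 < cquot f x n.+1 /\
  cquot f x n = (pquot f x n)%:~R + f (cquot f x n.+1).
Proof.
rewrite cquotSn => /fracpart_itvoo t01.
by rewrite f_phi ?phi_gt1 // /pquot -floor_fracpart.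
Qed.

(* Below, a chain is a sequence [X] with [X k = a k + f (X k.+1)] and
   [1 < X k.+1]; this forces [X] to be the sequence of complete quotients of
   [X 0] and [a] that of its partial quotients. *)
Lemma chain_step (X0 X1 : R) (a : int) : 1 < X1 -> X0 = a%:~R + f X1 ->
  [/\ Num.floor X0 = a, X0 \isn't a Num.int & phi f (fracpart X0) = X1].
Proof.
move=> X1gt X0E; have /andP[f0 f1] := f_itv X1gt.
have f01 : 0 <= f X1 < 1 by rewrite ltW.
rewrite X0E int_fracpart floor_int_add // fracpart_int_add // phiK //.
by rewrite gt_eqF.
Qed.

Lemma chain_cquot X a n :
  (forall k, (k < n)%N -> 1 < X k.+1 /\ X k = (a k)%:~R + f (X k.+1)) ->
  forall k, (k <= n)%N -> cquot f (X 0) k = X k.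
Proof.
move=> Xa; elim=> // k IH kn; rewrite cquotSn IH ?(ltnW kn) //.
by have [X1 /(chain_step X1)[]] := Xa _ kn.
Qed.

Lemma expansion_fin x n : cquot f x n \is a Num.int ->
  (forall k, (k < n)%N -> cquot f x k \isn't a Num.int) ->
  expansion f x = CFfin (pquot f x 0) [seq pquot f x k | k <- iota 1 n].
Proof.
move=> xn xk; rewrite /expansion; case: pselect => [h|]; last by case; exists n.
case: ex_minnP => m xm m_min; suff -> : m = n by [].
apply/eqP; rewrite eqn_leq m_min //= leqNgt.
by apply/negP => /xk; rewrite xm.
Qed.

Lemma expansion_inf x : (forall k, cquot f x k \isn't a Num.int) ->
  expansion f x = CFinf (pquot f x).
Proof.
move=> xk; rewrite /expansion; case: pselect => // -[n xn].
by have := xk n; rewrite xn.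
Qed.

Lemma expansion_cases x :
  (exists n, [/\ cquot f x n \is a Num.int,
     forall k, (k < n)%N -> cquot f x k \isn't a Num.int &
     expansion f x = CFfin (pquot f x 0) [seq pquot f x k | k <- iota 1 n]])
  \/ (forall k, cquot f x k \isn't a Num.int) /\
     expansion f x = CFinf (pquot f x).
Proof.
have [h|h] := pselect (exists n, cquot f x n \is a Num.int); last first.
  right; have xk k : cquot f x k \isn't a Num.int.
    by apply/negP => xk; apply: h; exists k.
  by split=> //; exact: expansion_inf.
left; case: (ex_minnP h) => n xn n_min; exists n.
have xk k : (k < n)%N -> cquot f x k \isn't a Num.int.
  by apply: contraTN => /n_min; rewrite -leqNgt.
by split=> //; exact: expansion_fin.
Qed.

Lemma chain_expansion_fin X a n :
  (forall k, (k < n)%N -> 1 < X k.+1 /\ X k = (a k)%:~R + f (X k.+1)) ->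
  X n = (a n)%:~R -> expansion f (X 0) = CFfin (a 0) [seq a k | k <- iota 1 n].
Proof.
move=> Xa Xn; have XE := chain_cquot Xa.
have pE k : (k <= n)%N -> pquot f (X 0) k = a k.
  move=> kn; rewrite /pquot XE //; move: kn; rewrite leq_eqVlt.
  case/orP => [/eqP->|kn]; first by rewrite Xn intrKfloor.
  by have [X1 /(chain_step X1)[]] := Xa _ kn.
rewrite (@expansion_fin _ n).
- rewrite pE //; congr CFfin; apply/eq_in_map => k; rewrite mem_iota => kn.
  by apply: pE; lia.
- by rewrite XE // Xn; exact: intr_int.
- move=> k kn; rewrite XE ?(ltnW kn) //.
  by have [X1 /(chain_step X1)[]] := Xa _ kn.
Qed.

Lemma chain_expansion_inf X a :
  (forall k, 1 < X k.+1 /\ X k = (a k)%:~R + f (X k.+1)) ->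
  expansion f (X 0) = CFinf a.
Proof.
move=> Xa.
have XE k : cquot f (X 0) k = X k.
  by apply: (@chain_cquot X a k) => // j _; exact: Xa.
rewrite expansion_inf.
  congr CFinf; apply/funext => k; rewrite /pquot XE.
  by have [X1 /(chain_step X1)[]] := Xa k.
by move=> k; rewrite XE; have [X1 /(chain_step X1)[]] := Xa k.
Qed.

(** * Convergents and their limits *)

Lemma convergentS a n :
  convergent f a n.+1 =
  (a 0)%:~R + ext1 f (convergent f (fun k => a k.+1) n).
Proof.
by rewrite /convergent /= -[2%N]/(1 + 1)%N iotaDl -map_comp.
Qed.

(** By induction the tail is at least 1, where [ext1 f] takes values in ]0, 1]. The upper bound is
    attained when the tail has value 1, as in [a0; 1]. *)
Lemma convergent_itv a n : (forall j, (1 <= j)%N -> 1 <= a j) ->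
  (a 0)%:~R <= convergent f a n <= (a 0)%:~R + 1.
Proof.
elim: n a => [|n IH] a a1; first by rewrite /convergent /=; lra.
have /andP[+ _] := IH (fun k => a k.+1) (fun j _ => a1 j.+1 isT).
have : 1 <= (a 1)%:~R :> R by rewrite ler1z a1.
rewrite convergentS => /le_trans h /h /ext1_itv; lra.
Qed.

Lemma chain_convergent_fin X a n :
  (forall k, (k < n)%N -> 1 < X k.+1 /\ X k = (a k)%:~R + f (X k.+1)) ->
  X n = (a n)%:~R -> convergent f a n = X 0.
Proof.
elim: n X a => [|n IH] X a Xa Xn; first by rewrite Xn.
rewrite convergentS (IH (fun k => X k.+1)) //.
  by have [X1 ->] := Xa 0 isT; rewrite ext1_gt1.
by move=> k kn; exact: Xa.
Qed.

(* Since [f] is decreasing, [X 0] lies between any two consecutive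
   convergents. *)
Lemma chain_convergent_between X a n :
  (forall j, (1 <= j)%N -> 1 <= a j) ->
  (forall k, 1 < X k.+1 /\ X k = (a k)%:~R + f (X k.+1)) ->
  convergent f a n <= X 0 <= convergent f a n.+1 \/
  convergent f a n.+1 <= X 0 <= convergent f a n.
Proof.
elim: n X a => [|n IH] X a a1 Xa.
  (* The first two convergents are [a 0] and [a 0 + ext1 f (a 1)]; the latter is the upper bound
     because [a 1 <= X 1]. *)
  left; rewrite convergentS /convergent /=; have [X1 ->] := Xa 0.
  have a11 : 1 <= (a 1)%:~R :> R by rewrite ler1z a1.
  have : (a 1)%:~R <= X 1.
    by have [X2 ->] := Xa 1; have := f_itv X2; lra.
  by move=> /(ext1_le a11); rewrite ext1_gt1 //; have := f_itv X1; lra.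
have a1' j : (1 <= j)%N -> 1 <= a j.+1 by move=> _; exact: a1.
have a11 : 1 <= (a 1)%:~R :> R by rewrite ler1z a1.
have c1 m : 1 <= convergent f (fun k => a k.+1) m.
  by have := convergent_itv m a1'; lra.
rewrite !(convergentS _ n) (convergentS _ n.+1); have [X1 ->] := Xa 0.
rewrite -(ext1_gt1 X1) !lerD2l.
case: (IH (fun k => X k.+1) (fun k => a k.+1) a1' (fun k => Xa k.+1))
  => /andP[h1 h2]; [right|left]; by rewrite !ext1_le // ltW.
Qed.

(** The distance from [X 0] to a convergent is at most the gap between two consecutive convergents,
    and this gap tends to 0 when they converge. *)
Lemma chain_convergent_inf X a :
  (forall j, (1 <= j)%N -> 1 <= a j) ->
  (forall k, 1 < X k.+1 /\ X k = (a k)%:~R + f (X k.+1)) ->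
  cvgn (convergent f a) -> limn (convergent f a) = X 0.
Proof.
move=> a1 Xa /cvg_ex[l cl]; apply: cvg_lim => //.
have cl1 : convergent f a n.+1 @[n --> \oo] --> l by rewrite cvg_shiftS.
have gap : convergent f a n.+1 - convergent f a n @[n --> \oo] --> (0 : R).
  by rewrite -(subrr l); exact: cvgB.
move/cvgrPdist_lt: gap => gap.
apply/cvgrPdist_lt => e /gap; apply: filterS => n; rewrite sub0r normrN.
apply: le_lt_trans.
by case: (chain_convergent_between n a1 Xa) => ?; do 2 case: ler0P => ?; lra.
Qed.

(** The tail never exceeds [a 1 + 1], so all convergents but the first are at least
    [a 0 + ext1 f (a 1 + 1)]. This fixed bound above 1 makes the inequality survive the limit, which
    places the limit in the domain of [f]. *)
Lemma limn_convergent_gt1 a : (forall j, 1 <= a j) ->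
  cvgn (convergent f a) -> 1 < limn (convergent f a).
Proof.
move=> a1 ca.
have a1' j : (1 <= j)%N -> 1 <= a j.+1 by move=> _; exact: a1.
have a10 : 1 <= (a 0)%:~R :> R by rewrite ler1z.
have a11 : 1 <= (a 1)%:~R :> R by rewrite ler1z.
have /andP[e0 _] : 0 < ext1 f ((a 1)%:~R + 1) <= 1 by apply: ext1_itv; lra.
apply: (@lt_le_trans _ _ ((a 0)%:~R + ext1 f ((a 1)%:~R + 1))); first lra.
apply: limr_ge => //; exists 1%N => // -[//|n] _.
rewrite convergentS lerD2l; apply: ext1_le.
  by have := convergent_itv n a1'; lra.
by have := convergent_itv n a1'; lra.
Qed.

Lemma limn_convergentS a : (forall j, (1 <= j)%N -> 1 <= a j) ->
  cvgn (convergent f (fun k => a k.+1)) ->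
  limn (convergent f a) =
  (a 0)%:~R + f (limn (convergent f (fun k => a k.+1))).
Proof.
move=> a1 ca; have l1 := limn_convergent_gt1 (fun j => a1 j.+1 isT) ca.
apply: cvg_lim => //; rewrite -cvg_shiftS.
under eq_fun do rewrite convergentS.
apply: cvgD; first exact: cvg_cst.
set a' := fun k => a k.+1 in ca l1 *; set l := limn _ in l1 *.
have [_ _ f_cont _ _] := classF_decreasing_bijection.
(* Since [l > 1], [ext1 f] and [f] agree near [l], and the continuity of [f] applies. *)
have ext1_cont : ext1 f u @[u --> l] --> f l.
  apply: cvg_trans (f_cont l _); last by rewrite in_itv /= l1.
  apply: near_eq_cvg; near=> u.
  by rewrite ext1_gt1 //; near: u; exact: lt_nbhsr.
exact: (cvg_comp _ _ ca ext1_cont).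
Unshelve. all: by end_near. Qed.

(** If [s] is empty, the condition on the last entry gives [a0 >= 2]; otherwise the tail adds a
    positive amount to [a0 >= 1]. *)
Lemma eval_fin_gt1 (a0 : int) (s : seq int) :
  1 <= a0 -> all (fun b : int => 1 <= b) s -> 2 <= last a0 s ->
  1 < eval_fin f a0 s.
Proof.
move=> a1; have a1R : 1 <= a0%:~R :> R by rewrite ler1z.
case: s => [|a s] /=; first by rewrite ltr1z; lia.
move=> /andP[a1' s1] _.
suff /ext1_itv : 1 <= eval_fin f a s by lra.
elim: s a a1' s1 => [|b s IH] a a1' /=; first by rewrite ler1z.
move=> /andP[b1 s1]; have /ext1_itv := IH b b1 s1.
by have : 1 <= a%:~R :> R by [rewrite ler1z]; lra.
Qed.

(** * Faithfulness from convergence *)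

Lemma expansion_cf_set x : cf_set (expansion f x).
Proof.
have pquot_ge1 k : cquot f x k \isn't a Num.int -> 1 <= pquot f x k.+1.
  by move=> /cquot_step[x1 _]; exact: floor_ge1.
case: (expansion_cases x) => [[n [xn xk ->]]|[xk ->]]; [left|right]; last first.
  by exists (pquot f x); split=> // -[//|j] _; exact: pquot_ge1.
exists (pquot f x 0), [seq pquot f x k | k <- iota 1 n]; split=> //.
  apply/allP => _ /mapP[[|k] + ->]; rewrite mem_iota // => kn.
  by apply/pquot_ge1/xk; lia.
case: n xn xk => // n xn xk _.
rewrite -(addn1 n) iotaD map_cat last_cat /= add1n.
(* The last complete quotient is an integer greater than 1, so the last partial quotient is at least
   2. *)
have [x1 _] := cquot_step (xk n (ltnSn n)).
move: xn x1; rewrite intrEfloor => /eqP xn; rewrite -xn /pquot ltr1z; lia.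
Qed.

(** Complete quotients of a number form a chain, and so do the values of the tails of a sequence.
    Evaluating the first chain and expanding the second shows that the two maps are mutually
    inverse. *)
Lemma faithful_of_evaluation_defined :
  (forall a, (forall j, (1 <= j)%N -> 1 <= a j) -> cvgn (convergent f a)) ->
  faithful f.
Proof.
move=> f_cvg.
have ev_exp x : evaluation f (expansion f x) = x.
  have xset := expansion_cf_set x; move: xset.
  case: (expansion_cases x) => [[n [xn xk ->]]|[xk ->]] xset.
    apply: (@chain_convergent_fin (cquot f x) (pquot f x) n).
      by move=> k /xk/cquot_step[].
    by apply/esym/eqP; rewrite -intrEfloor.
  have [[? [? []] //]|[a [[<-] a1]]] := xset.
  apply: (@chain_convergent_inf (cquot f x)) => //; last exact: f_cvg.
  by move=> k; have [] := cquot_step (xk k).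
have exp_ev c : cf_set c -> expansion f (evaluation f c) = c.
  case=> [[a0 [s [-> s1 sl]]]|[a [-> a1]]] /=; last first.
    (* [X k] is the value of the tail [a k; a k.+1, ..]. *)
    pose X k := limn (convergent f (fun j => a (k + j)%N)).
    apply: (@chain_expansion_inf X) => k; rewrite {2}/X.
    have ge1 m j : (1 <= j)%N -> 1 <= a (m + j)%N by move=> ?; apply: a1; lia.
    have shift : (fun j => a (k + j.+1)%N) = (fun j => a (k.+1 + j)%N).
      by apply/funext => j; rewrite addnS.
    split.
      by apply: limn_convergent_gt1 => [j|]; [exact: a1|exact/f_cvg/ge1].
    rewrite limn_convergentS ?addn0 ?shift //; first exact: ge1.
    exact/f_cvg/ge1.
  pose l := a0 :: s.
  (* Again [X k] is the value of the tail starting at entry [k]; the chain stops at the integer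
     [X (size s)]. *)
  pose X k := eval_fin f (nth 0 l k) (drop k.+1 l).
  have -> : eval_fin f a0 s = X 0 by rewrite /X /= drop0.
  rewrite (@chain_expansion_fin X (nth 0 l) (size s)).
  - congr CFfin; rewrite -[1%N]/(1 + 0)%N iotaDl -map_comp.
    by rewrite -[RHS](@take_size _ s) -(map_nth_iota0 0).
  - move=> k ks; have XE : X k = (nth 0 l k)%:~R + ext1 f (X k.+1).
      by rewrite /X [drop k.+1 l](drop_nth 0).
    suff X1 : 1 < X k.+1 by rewrite XE ext1_gt1.
    apply: eval_fin_gt1.
    + by have /allP := s1; apply; exact: mem_nth.
    + by apply/allP => z zs; apply/(allP s1)/(mem_drop (n0 := k.+1)).
    (* A tail has the same last entry as the whole sequence, so it inherits the bound 2. *)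
    + have -> : last (nth 0 l k.+1) (drop k.+2 l) = last a0 s.
        by rewrite -[in RHS](cat_take_drop k s) last_cat [drop k s](drop_nth 0).
      by apply: sl; case: (s) ks.
  - by rewrite /X /= drop_size.
split=> //.
- exact: classF_decreasing_bijection.
- by move=> _ [[a0 [s [-> _ _]]]//|[a [-> a1]]]; exact: f_cvg.
- split=> [x _|x y _ _ xy|c cset]; first exact: expansion_cf_set.
    by rewrite -(ev_exp x) xy ev_exp.
  by exists (evaluation f c) => //; exact: exp_ev.
Qed.

End DecreasingBijection.

(** * The Moebius distortion, its lift to the line, and the conjugated reciprocal *)

Section Distortion.
Variable R : realType.
Implicit Types (c s t u v : R) (a : nat -> int).

Definition distort c t : R := c * t / (1 - t + c * t).

Lemma distort_den c t : 0 < c -> 0 <= t <= 1 -> 0 < 1 - t + c * t.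
Proof.
move=> c0 /andP[t0 t1]; case: (ltP t 1) => [t1'|t1'].
  by have := mulr_ge0 (ltW c0) t0; lra.
by have -> : t = 1 by [lra]; rewrite subrr add0r mulr1.
Qed.

Lemma distort0 c : distort c 0 = 0.
Proof. by rewrite /distort mulr0 mul0r. Qed.

Lemma distort1 c : 0 < c -> distort c 1 = 1.
Proof. by move=> c0; rewrite /distort subrr add0r mulr1 divff // gt_eqF. Qed.

Lemma distort_lt c s t : 0 < c -> 0 <= s -> s < t -> t <= 1 ->
  distort c s < distort c t.
Proof.
move=> c0 s0 st t1.
have ds := @distort_den c s c0 ltac:(lra).
have dt := @distort_den c t c0 ltac:(lra).
rewrite /distort ltr_pdivrMr // mulrAC ltr_pdivlMr // -subr_gt0.
suff -> : c * t * (1 - s + c * s) - c * s * (1 - t + c * t) = c * (t - s).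
  by rewrite mulr_gt0 // subr_gt0.
by ring.
Qed.

Lemma distort_itvoo c t : 0 < c -> 0 < t < 1 -> 0 < distort c t < 1.
Proof.
move=> c0 /andP[t0 t1]; have := distort_lt c0 (lexx 0) t0 (ltW t1).
have := distort_lt c0 (ltW t0) t1 (lexx 1).
by rewrite distort0 distort1 // => -> ->.
Qed.

Lemma distort_itv c t : 0 < c -> 0 <= t < 1 -> 0 <= distort c t < 1.
Proof.
move=> c0 /andP[]; rewrite le_eqVlt => /orP[/eqP<-|t0 t1].
  by rewrite distort0 lexx ltr01.
by have := @distort_itvoo c t c0 ltac:(lra); lra.
Qed.

Lemma distortK c t : 0 < c -> 0 <= t <= 1 -> distort c^-1 (distort c t) = t.
Proof.
move=> c0 t01; have dt := distort_den c0 t01.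
rewrite /distort; set d := 1 - t + c * t in dt *.
have -> : 1 - c * t / d + c^-1 * (c * t / d) = d^-1.
  by rewrite /d; field; rewrite -/d !gt_eqF.
by field; rewrite !gt_eqF.
Qed.

(** The bijection H of the line: it fixes the integers and acts by [distort c] on fractional
    parts. *)
Definition lift_distort c t : R :=
  (Num.floor t)%:~R + distort c (fracpart t).

Lemma lift_distort_floor c t : 0 < c ->
  Num.floor (lift_distort c t) = Num.floor t.
Proof. by move=> c0; rewrite floor_int_add // distort_itv // fracpart_itv. Qed.

Lemma lift_distortK c : 0 < c -> cancel (lift_distort c) (lift_distort c^-1).
Proof.
move=> c0 t; rewrite {1}/lift_distort lift_distort_floor //.
have t01 := fracpart_itv t.
rewrite fracpart_int_add ?distort_itv // distortK; [|by []|lra].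
by rewrite -floor_fracpart.
Qed.

(** With equal floors this is monotonicity of [distort c]; otherwise the integer [floor s + 1]
    separates the images. *)
Lemma lift_distort_lt c : 0 < c -> {homo lift_distort c : s t / s < t}.
Proof.
move=> c0 s t st; have s01 := fracpart_itv s; have t01 := fracpart_itv t.
have : Num.floor s <= Num.floor t by apply/le_floor/ltW.
rewrite le_eqVlt => /orP[/eqP fst|fst].
  rewrite /lift_distort fst ltrD2l distort_lt //; [lra| |lra].
  by rewrite /fracpart fst ltrD2r.
apply: (@lt_le_trans _ _ ((Num.floor s)%:~R + 1)).
  by rewrite ltrD2l; have := distort_itv c0 s01; lra.
apply: (@le_trans _ _ (Num.floor t)%:~R).
  by rewrite -(intrD _ _ 1) ler_int; lia.
by rewrite lerDl; have := distort_itv c0 t01; lra.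
Qed.

Lemma lift_distort1 c : lift_distort c 1 = 1.
Proof. by rewrite /lift_distort /fracpart floor1 subrr distort0 addr0. Qed.

Lemma lift_distort_gt1 c t : 0 < c -> 1 < t -> 1 < lift_distort c t.
Proof. by move=> c0 t1; rewrite -(lift_distort1 c) lift_distort_lt. Qed.

(** This is H o (1/u) o H^-1 on ]1, +oo[: the reciprocal there lies in ]0, 1[, where H is just
    [distort c]. *)
Definition conj_recip c u : R := distort c (lift_distort c^-1 u)^-1.

Lemma conj_recip_lift c v : 0 < c ->
  conj_recip c (lift_distort c v) = distort c v^-1.
Proof. by move=> c0; rewrite /conj_recip lift_distortK. Qed.

Lemma inv_itv u : 1 < u -> 0 < u^-1 < 1.
Proof. by move=> u1; rewrite invr_gt0 invf_lt1 ?u1 // ?(lt_trans ltr01). Qed.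

Lemma conj_recip_itv c u : 0 < c -> 1 < u -> 0 < conj_recip c u < 1.
Proof.
move=> c0 u1; apply: distort_itvoo => //; apply: inv_itv.
by rewrite lift_distort_gt1 // invr_gt0.
Qed.

Lemma conj_recip_lt c u v : 0 < c -> 1 < u -> u < v ->
  conj_recip c v < conj_recip c u.
Proof.
move=> c0 u1 uv; have ci0 : 0 < c^-1 by rewrite invr_gt0.
have Hu := lift_distort_gt1 ci0 u1; have Huv := lift_distort_lt ci0 uv.
have /andP[i0 _] := inv_itv (lt_trans Hu Huv).
have /andP[_ i1] := inv_itv Hu.
apply: distort_lt => //; [exact: ltW| |exact: ltW].
by rewrite ltf_pV2 // posrE; lra.
Qed.

Lemma conj_recip_surj c t : 0 < c -> 0 < t < 1 ->
  exists2 u, 1 < u & conj_recip c u = t.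
Proof.
move=> c0 t01; have ci0 : 0 < c^-1 by rewrite invr_gt0.
have /andP[s0 s1] := distort_itvoo ci0 t01.
(* Obtained by solving [conj_recip c u = t] for [u]: undo [distort c], invert, apply H. *)
exists (lift_distort c (distort c^-1 t)^-1).
  by rewrite lift_distort_gt1 // invf_gt1.
rewrite conj_recip_lift // invrK -[c in distort c]invrK distortK //.
by case/andP: t01 => ? ?; rewrite !ltW.
Qed.

(** * Convergence of the usual continued fraction *)

Lemma recip_itv u : 1 < u -> 0 < recip u < 1.
Proof. exact: inv_itv. Qed.

Lemma recip_lt u v : 1 < u -> u < v -> recip v < recip u.
Proof. by move=> u1 uv; rewrite /recip ltf_pV2 // posrE; lra. Qed.

Lemma recip_surj t : 0 < t < 1 -> exists2 u, 1 < u & recip u = t.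
Proof.
move=> /andP[t0 t1]; exists t^-1; last by rewrite /recip invrK.
by rewrite invf_gt1.
Qed.

Lemma ext1_recip u : ext1 (@recip R) u = u^-1.
Proof. by rewrite /ext1; case: eqP => // ->; rewrite invr1. Qed.

Lemma recip_convergent_ge1 a n : (forall j, 1 <= a j) ->
  1 <= convergent (@recip R) a n.
Proof.
move=> a1; have := convergent_itv recip_itv n (fun j _ => a1 j).
by have : 1 <= (a 0)%:~R :> R by [rewrite ler1z]; lra.
Qed.

(* Two steps of the continued fraction, [s |-> p + 1 / (q + 1 / s)], contract
   distances on [1, +oo[ by the factor 1 / ((q s + 1) (q t + 1)) <= 1 / 4. *)
Lemma recip_convergent_contract a k m n : (forall j, 1 <= a j) ->
  `|convergent (@recip R) a (k.*2 + m) - convergent (@recip R) a (k.*2 + n)|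
    <= 4^-1 ^+ k.
Proof.
elim: k a => [|k IH] a a1.
  have a1' j : (1 <= j)%N -> 1 <= a j by move=> _; exact: a1.
  have := convergent_itv recip_itv m a1'.
  have := convergent_itv recip_itv n a1'.
  by rewrite expr0 !add0n ler_norml; lra.
have a1' j : 1 <= a j.+2 by exact: a1.
rewrite doubleS !addSn !convergentS !ext1_recip /=.
move: (IH (fun j => a j.+2) a1').
move: (recip_convergent_ge1 (k.*2 + n) a1').
move: (recip_convergent_ge1 (k.*2 + m) a1').
set s := convergent _ _ _; set t := convergent _ _ _ => s1 t1 st.
have q1 : 1 <= (a 1)%:~R :> R by rewrite ler1z.
move: (a 0)%:~R (a 1)%:~R q1 => p q q1.
have qs : 2 <= q * s + 1 by nra.
have qt : 2 <= q * t + 1 by nra.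
have s0 : 0 < s by lra.
have t0 : 0 < t by lra.
have -> : p + (q + s^-1)^-1 - (p + (q + t^-1)^-1) =
    (s - t) / ((q * s + 1) * (q * t + 1)).
  field; rewrite !gt_eqF //=; lra.
have d4 : 4 <= (q * s + 1) * (q * t + 1) by nra.
set D := _ * _ in d4 *; have D0 : 0 < D by lra.
rewrite normrM normfV (gtr0_norm D0) ler_pdivrMr // exprS.
apply: le_trans st _; set E := _ ^+ k.
have E0 : 0 <= E by apply: exprn_ge0; lra.
by nra.
Qed.

(** The sequence is Cauchy: every convergent of index at least [2k] is within [4^-k] of the one of
    index [2k]. *)
Lemma is_cvg_recip_convergent a : (forall j, 1 <= a j) ->
  cvgn (convergent (@recip R) a).
Proof.
move=> a1; apply/cauchy_cvgP/cauchy_exP => e e0.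
have : (4^-1 : R) ^+ n @[n --> \oo] --> 0.
  by apply: cvg_expr; rewrite ger0_norm; lra.
move=> /cvgrPdist_lt/(_ _ e0)[k _ /(_ k (leqnn _))].
rewrite /= sub0r normrN => ke.
exists (convergent (@recip R) a k.*2); exists k.*2 => // n /= kn.
rewrite /ball /=; apply: le_lt_trans ke.
rewrite (@ger0_norm _ (_ ^+ k)) ?exprn_ge0 //.
by have := recip_convergent_contract k 0 (n - k.*2) a1; rewrite addn0 subnKC.
Qed.

(** * Transfer from the reciprocal to its conjugate *)

Lemma conj_recip_ext1 c v : 0 < c -> 1 <= v ->
  ext1 (conj_recip c) (lift_distort c v) = distort c v^-1.
Proof.
move=> c0; rewrite le_eqVlt => /orP[/eqP<-|v1].
  by rewrite lift_distort1 invr1 distort1 // /ext1 eqxx.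
by rewrite ext1_gt1 ?conj_recip_lift // lift_distort_gt1.
Qed.

Lemma lift_distort_convergent c a n :
  0 < c -> (forall j, (1 <= j)%N -> 1 <= a j) ->
  convergent (conj_recip c) a n = lift_distort c (convergent (@recip R) a n).
Proof.
move=> c0; elim: n a => [|n IH] a a1.
  rewrite /convergent /= /lift_distort /fracpart intrKfloor subrr.
  by rewrite distort0 addr0.
have a1' j : 1 <= a j.+1 by exact: a1.
rewrite !convergentS ext1_recip IH //.
have := recip_convergent_ge1 n a1'; set v := convergent _ _ _ => v1.
(* For [v = 1] the reciprocal is 1 and not a fractional part: the floor moves up, and both sides
   equal [a 0 + 1]. For [v > 1] the floor is [a 0]. *)
rewrite conj_recip_ext1 //; move: v1; rewrite le_eqVlt => /orP[/eqP<-|v1].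
  rewrite invr1 distort1 // /lift_distort -(intrD _ _ 1) /fracpart.
  by rewrite intrKfloor subrr distort0 addr0.
have /andP[i0 i1] := inv_itv v1.
have i01 : 0 <= v^-1 < 1 by rewrite ltW.
by rewrite /lift_distort floor_int_add // fracpart_int_add.
Qed.

Lemma distort_continuous c t : 0 < c -> 0 <= t <= 1 ->
  {for t, continuous (distort c)}.
Proof.
move=> c0 t01; have d0 := distort_den c0 t01.
apply: cvgM; first by apply: cvgM; [exact: cvg_cst|exact: cvg_id].
apply: cvgV; first by rewrite gt_eqF.
apply: cvgD; last by apply: cvgM; [exact: cvg_cst|exact: cvg_id].
by apply: cvgB; [exact: cvg_cst|exact: cvg_id].
Qed.

(** After peeling off [a 0], the tail is a usual convergent with limit [l >= 1], so continuity of
    [distort c] at [l^-1] in [0, 1] suffices, and continuity of H at integers never arises. *)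
Lemma is_cvg_conj_recip_convergent c a : 0 < c ->
  (forall j, (1 <= j)%N -> 1 <= a j) -> cvgn (convergent (conj_recip c) a).
Proof.
move=> c0 a1; pose a' j := a j.+1.
have a1' j : 1 <= a' j by exact: a1.
have ca := is_cvg_recip_convergent a1'.
set l := limn (convergent (@recip R) a') in ca.
have l1 : 1 <= l by apply: limr_ge => //; near=> n; exact: recip_convergent_ge1.
have l0 : 0 < l by lra.
apply/cvg_ex; exists ((a 0)%:~R + distort c l^-1).
rewrite -cvg_shiftS.
have E n : convergent (conj_recip c) a n.+1 =
    (a 0)%:~R + distort c (convergent (@recip R) a' n)^-1.
  rewrite convergentS lift_distort_convergent // => [|j _]; last exact: a1'.
  by rewrite conj_recip_ext1 // recip_convergent_ge1.
under eq_fun do rewrite E.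
apply: cvgD; first exact: cvg_cst.
apply: (@continuous_cvg _ _ _ _ _
  (fun n => (convergent (@recip R) a' n)^-1) (distort c)).
  by apply: distort_continuous => //; rewrite invr_ge0 ltW //= invf_le1.
by apply: cvgV => //; rewrite gt_eqF.
Unshelve. all: by end_near. Qed.

Lemma conj_recip_faithful c : 0 < c -> faithful (conj_recip c).
Proof.
move=> c0; apply: faithful_of_evaluation_defined.
- by move=> u; exact: conj_recip_itv.
- by move=> u v; exact: conj_recip_lt.
- by move=> t; exact: conj_recip_surj.
- by move=> a; exact: is_cvg_conj_recip_convergent.
Qed.

(** The images under H of the usual complete quotients of [t] form a chain for [conj_recip c] with
    the same partial quotients. *)
Lemma expansion_lift_distort c t : 0 < c ->
  expansion (conj_recip c) (lift_distort c t) = expansion (@recip R) t.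
Proof.
move=> c0; pose X k := lift_distort c (cquot (@recip R) t k).
have Xstep k : cquot (@recip R) t k \isn't a Num.int ->
    1 < X k.+1 /\ X k = (pquot (@recip R) t k)%:~R + conj_recip c (X k.+1).
  move=> tk; have [t1 _] := cquot_step recip_lt recip_surj tk.
  split; first exact: lift_distort_gt1.
  rewrite conj_recip_lift // cquotSn -[_^-1]/(recip _).
  by rewrite (f_phi recip_lt recip_surj) // fracpart_itvoo.
have I u v : 1 < u -> u < v -> conj_recip c v < conj_recip c u.
  exact: conj_recip_lt.
have J u : 1 < u -> 0 < conj_recip c u < 1 by exact: conj_recip_itv.
case: (expansion_cases (@recip R) t) => [[n [tn tk ->]]|[tk ->]].
  apply: (chain_expansion_fin J I (X := X)) => [k kn|]; first exact/Xstep/tk.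
  move: tn; rewrite intrEfloor => /eqP tn.
  by rewrite /X -tn /lift_distort /fracpart intrKfloor subrr distort0 addr0.
by apply: (chain_expansion_inf J I (X := X)) => k; exact/Xstep/tk.
Qed.

End Distortion.

Theorem theorem1 (R : realType) (x y : R) (hx : 0 < x < 1) (hy : 0 < y < 1) :
  exists f : R -> R,
    [/\ classF f, faithful f & expansion f x = expansion (@recip R) y].
Proof.
have /andP[x0 x1] := hx; have /andP[y0 y1] := hy.
(* [distort c] multiplies the odds [t / (1 - t)] by [c], so [c] is the odds of [x] divided by the
   odds of [y]. *)
pose c := x * (1 - y) / (y * (1 - x)).
have c0 : 0 < c by rewrite divr_gt0 // mulr_gt0 // subr_gt0.
have f_faithful := conj_recip_faithful c0.
exists (conj_recip c); split=> //; first by case: f_faithful.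
rewrite -(expansion_lift_distort y c0); congr expansion.
have y01 : 0 <= y < 1 by rewrite ltW.
(* Writing [y] as [0 + y] exhibits its floor 0 and fractional part [y]. *)
rewrite /lift_distort -[y](add0r y) -[0]/((0 : int)%:~R).
rewrite floor_int_add // fracpart_int_add // add0r.
have d0 : 1 - y + c * y = (1 - y) / (1 - x).
  by rewrite /c; field; rewrite !gt_eqF // subr_gt0.
by rewrite /distort d0 /c; field; rewrite !gt_eqF // subr_gt0.
Qed.
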